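(* Assume $\phi=\tilde p/p$ satisfies (A1). Then $\mathcal{K}^1_{(1,1)}=\mathcal{K}^2_{(1,1)}$; that is, the $z_1$-contact order and the $z_2$-contact order of $\phi$ at $(1,1)$ are equal.
   Context: $\mathbb{D}$ is the open unit disk, $\mathbb{T}$ the unit circle, $\Pi$ the open upper half-plane, $\beta(w)=\frac{1+iw}{1-iw}$ (a conformal map $\Pi\to\mathbb{D}$), $\beta^{-1}(z)=i\frac{1-z}{1+z}$. For a polynomial $p\in\mathbb{C}[z_1,z_2]$ of bidegree $(m,n)$, its reflection is $\tilde p(z_1,z_2)=z_1^mz_2^n\overline{p(1/\bar z_1,1/\bar z_2)}$. A rational inner function (RIF) on $\mathbb{D}^2$ is a rational function that is holomorphic and bounded on $\mathbb{D}^2$ with $|\phi|=1$ a.e. on $\mathbb{T}^2$. We write $f\approx g$ if each of $f,g$ is bounded by a positive constant multiple of the other. (A1): $\phi=\tilde p/p$ is an RIF on $\mathbb{D}^2$, where $p$ has no zeros in $\mathbb{D}^2$ and $p,\tilde p$ have no common factor; $\phi$ has a singularity at $(1,1)$ (i.e. $p(1,1)=0$, hence also $\tilde p(1,1)=0$); and the non-tangential value of $\phi$ at $(1,1)$ is $1$. Contact order. Let $q(w_1,w_2)=(1-iw_1)^m(1-iw_2)^n\tilde p(\beta(w_1),\beta(w_2))$. Near $(0,0)$ factor $q=\alpha q_1\cdots q_L$ with $\alpha$ a unit and $q_k$ irreducible Weierstrass polynomials in $w_1$ of degree $N_k$; the zero set of $q_k$ is given by a Puiseux series $w_1=\Psi^0_k(w_2^{1/N_k})$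 with $\Psi_k^0$ a convergent power series, $\Psi^0_k(0)=0$. Choosing the $N_k$ branches of the root with discontinuity only on $(-\infty,0]$, one gets $L_0=N_1+\dots+N_L$ functions $\psi^0_\ell(z_2)=\beta\big(\Psi^0_k(\beta^{-1}(z_2)^{1/N_k})\big)$; the curves $z_1=\psi^0_\ell(z_2)$ are the branches of $\mathcal{Z}_{\tilde p}=\{\tilde p=0\}$ near $(1,1)$. For each branch there is an even number $\mathcal{K}^1_\ell$, its $z_1$-contact order, with $1-|\psi^0_\ell(\zeta_2)|\approx|1-\zeta_2|^{\mathcal{K}^1_\ell}$ for $\zeta_2\in\mathbb{T}$ close to $1$. The $z_1$-contact order of $\phi$ at $(1,1)$ is $\mathcal{K}^1_{(1,1)}=\max_\ell\mathcal{K}^1_\ell$. The $z_2$-contact order $\mathcal{K}^2_{(1,1)}$ is defined in the same way with the roles of $z_1$ and $z_2$ interchanged (writing the branches of $\mathcal{Z}_{\tilde p}$ near $(1,1)$ as $z_2=\hat\psi^0_j(z_1)$, with $1-|\hat\psi^0_j(\zeta_1)|\approx|1-\zeta_1|^{\mathcal{K}^2_j}$ for $\zeta_1\in\mathbb{T}$ near $1$). *)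

(* Defs.v *)
From HB Require Import structures.
From mathcomp Require Import all_boot all_order all_algebra.
From mathcomp Require Import all_classical all_reals all_analysis.
From mathcomp.real_closed Require Import complex.
From mathcomp Require Import polyXY ring.

Set Implicit Arguments.
Unset Strict Implicit.
Unset Printing Implicit Defensive.

Import Order.TTheory GRing.Theory Num.Theory.
Import numFieldNormedType.Exports.

Local Open Scope classical_set_scope.
Local Open Scope ring_scope.

(* R[i], seen as a numClosedFieldType so that it carries the topology of its
   norm.  Its order is partial: [x <= y] says that y - x is a nonnegative real,
   so that [0 < c] means that c is a positive real number. *)
Definition Cplx (R : realType) : numClosedFieldType := R[i].
Arguments Cplx : simpl never.

Section Definitions.
Context {R : realType}.
Local Notation C := (Cplx R).

Definition bidisk : set (C * C) := [set z | `|z.1| < 1 /\ `|z.2| < 1].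

Definition circle : set C := [set z | `|z| = 1].

Definition expi (t : R) : C := Complex (cos t) (sin t).

Definition cayley (w : C) : C := (1 + 'i * w) / (1 - 'i * w).

Definition cayley_inv (z : C) : C := 'i * ((1 - z) / (1 + z)).

(* In {poly {poly C}} the outer variable is z_1 and the inner one is z_2: the
   coefficient of z_1^j z_2^k in p is p`_j`_k. *)
Definition ev (p : {poly {poly C}}) (z : C * C) : C := p.[z.1%:P].[z.2].

Definition has_bidegree (m n : nat) (p : {poly {poly C}}) : Prop :=
  size p = m.+1 /\ sizeY p = n.+1.

(* z_1^m z_2^n conj(p(1/conj z_1, 1/conj z_2)), see [ev_reflection]. *)
Definition reflection (m n : nat) (p : {poly {poly C}}) : {poly {poly C}} :=
  \poly_(j < m.+1) \poly_(k < n.+1) (p`_(m - j)`_(n - k))^*.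

Lemma ev_wide (m n : nat) (p : {poly {poly C}}) (z : C * C) :
  (size p <= m.+1)%N -> (sizeY p <= n.+1)%N ->
  ev p z = \sum_(j < m.+1) \sum_(k < n.+1) p`_j`_k * z.2 ^+ k * z.1 ^+ j.
Proof.
move=> sp sYp; rewrite /ev (horner_coef_wide _ sp) horner_sum.
apply: eq_bigr => j _; rewrite hornerM horner_exp hornerC.
rewrite (@horner_coef_wide _ n.+1) ?mulr_suml //.
exact: leq_trans (max_size_coefXY _ _) sYp.
Qed.

Lemma ev_reflection (m n : nat) (p : {poly {poly C}}) (z : C * C) :
  has_bidegree m n p -> z.1 != 0 -> z.2 != 0 ->
  ev (reflection m n p) z =
  z.1 ^+ m * z.2 ^+ n * (ev p ((z.1^*)^-1, (z.2^*)^-1))^*.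
Proof.
move=> [sp sYp] z1 z2.
have sr : (size (reflection m n p) <= m.+1)%N by exact: size_poly.
have sYr : (sizeY (reflection m n p) <= n.+1)%N.
  apply/bigmax_leqP => i _; rewrite coef_poly; case: ifP => _; first exact: size_poly.
  by rewrite size_poly0.
rewrite (ev_wide _ sr sYr) (@ev_wide m n p) ?sp ?sYp // rmorph_sum mulr_sumr /=.
rewrite (reindex_inj rev_ord_inj) /=; apply: eq_bigr => j _.
rewrite rmorph_sum mulr_sumr /= (reindex_inj rev_ord_inj) /=.
apply: eq_bigr => k _.
rewrite !subSS !coef_poly !ltnS !leq_subr coef_poly ltnS leq_subr.
have jm : (j <= m)%N := valP j.
have kn : (k <= n)%N := valP k.
rewrite !subKn //.
rewrite !rmorphM !rmorphXn !fmorphV /= !conjCK.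
rewrite !exprVn -[in z.1 ^+ m](subnK jm) -[in z.2 ^+ n](subnK kn) !exprD.
by field; rewrite !expf_neq0.
Qed.

Definition no_common_factor (f g : {poly {poly C}}) : Prop :=
  forall d u v : {poly {poly C}},
    f = d * u -> g = d * v -> d \is a GRing.unit.

Definition rational (phi : C * C -> C) : Prop :=
  exists f g : {poly {poly C}},
    g != 0 /\ forall z, ev g z != 0 -> phi z = ev f z / ev g z.

Definition rational_inner (phi : C * C -> C) : Prop :=
  [/\ rational phi,
      forall z, bidisk z -> differentiable phi z,
      exists M : C, forall z, bidisk z -> `|phi z| <= M &
      {ae (@lebesgue_measure R \x @lebesgue_measure R)%E,
        forall st : R * R, `|phi (expi st.1, expi st.2)| = 1}].

(* {z in D^2 : ||z - (1,1)|| <= c (1 - ||z||)} for the max norm. *)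
Definition nontangential_region (c : C) : set (C * C) :=
  [set z | bidisk z /\
    [/\ `|z.1 - 1| <= c * (1 - `|z.1|), `|z.1 - 1| <= c * (1 - `|z.2|),
        `|z.2 - 1| <= c * (1 - `|z.1|) & `|z.2 - 1| <= c * (1 - `|z.2|)]].

Definition nontangential_value_at_11 (phi : C * C -> C) (l : C) : Prop :=
  forall c : C, 0 < c ->
    phi @ within (nontangential_region c) (nbhs (1 : C, 1 : C)) --> l.

Record A1 (m n : nat) (p : {poly {poly C}}) (phi : C * C -> C) : Prop := {
  A1_bidegree : has_bidegree m n p;
  A1_quotient : phi = fun z => ev (reflection m n p) z / ev p z;
  A1_inner : rational_inner phi;
  A1_nonvanishing : forall z, bidisk z -> ev p z != 0;
  A1_coprime : no_common_factor p (reflection m n p);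
  A1_singular : ev p (1, 1) = 0;
  A1_value : nontangential_value_at_11 phi 1 }.

(* Germs at the origin are represented by total functions, of which only the
   values near the origin matter. *)
Definition holomorphic1_at0 (f : C -> C) : Prop :=
  \forall w \near (0 : C), derivable f w 1.

Definition holomorphic2_at0 (f : C * C -> C) : Prop :=
  \forall w \near (0 : C, 0 : C), differentiable f w.

Definition unit_germ (f : C * C -> C) : Prop :=
  holomorphic2_at0 f /\ f (0, 0) != 0.

Definition irreducible_germ (f : C * C -> C) : Prop :=
  ~ unit_germ f /\
  forall g h : C * C -> C, holomorphic2_at0 g -> holomorphic2_at0 h ->
    (\forall w \near (0 : C, 0 : C), f w = g w * h w) ->
    unit_germ g \/ unit_germ h.

Definition weierstrass_poly (N : nat) (f : C * C -> C) : Prop :=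
  exists a : 'I_N -> C -> C,
    (forall i, holomorphic1_at0 (a i) /\ a i 0 = 0) /\
    \forall w \near (0 : C, 0 : C),
      f w = w.1 ^+ N + \sum_(i < N) a i w.2 * w.1 ^+ i.

Definition convergent_power_series (f : C -> C) : Prop :=
  exists c : nat -> C,
    \forall t \near (0 : C), series (fun n => c n * t ^+ n) @ \oo --> f t.

(* q = alpha q_1 ... q_L near (0,0), together with Puiseux parametrizations
   w_1 = Psi_k(w_2^(1/N_k)) of the zero sets of the q_k. *)
Record puiseux_factorization (q : C * C -> C) := {
  pf_unit : C * C -> C;
  pf_size : nat;
  pf_deg : 'I_pf_size -> nat;
  pf_factor : 'I_pf_size -> C * C -> C;
  pf_series : 'I_pf_size -> C -> C;
  pf_unitP : unit_germ pf_unit;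
  pf_factorP : forall k, weierstrass_poly (pf_deg k) (pf_factor k) /\
                         irreducible_germ (pf_factor k);
  pf_prod : \forall w \near (0 : C, 0 : C),
    q w = pf_unit w * \prod_(k < pf_size) pf_factor k w;
  pf_seriesP : forall k, convergent_power_series (pf_series k) /\
                         pf_series k 0 = 0;
  pf_zeros : forall k, \forall w \near (0 : C, 0 : C),
    pf_factor k w = 0 <->
    exists t : C, t ^+ pf_deg k = w.2 /\ w.1 = pf_series k t }.

Arguments pf_deg {q} _ _.
Arguments pf_series {q} _ _ _.
Arguments pf_size {q} _.

(* r 0, ..., r (N - 1) are the N branches of the N-th root with discontinuity
   only on the negative real half-line; [w <= 0] in the order of C says that w
   lies on that half-line.  On it the values of the branches are only required
   to enumerate the roots. *)
Definition root_branches (N : nat) (r : 'I_N -> C -> C) : Prop :=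
  [/\ forall j w, r j w ^+ N = w,
      forall w, w != 0 -> injective (fun j => r j w) &
      forall j w, ~ (w <= 0) -> {for w, continuous (r j)}].

Definition comparable_near1 (f g : C -> C) : Prop :=
  exists2 c : C, 0 < c &
    \forall zeta \near within circle (nbhs (1 : C)),
      f zeta <= c * g zeta /\ g zeta <= c * f zeta.

Definition cayley_pullback (m n : nat) (f : C * C -> C) (w : C * C) : C :=
  (1 - 'i * w.1) ^+ m * (1 - 'i * w.2) ^+ n * f (cayley w.1, cayley w.2).

Definition branch (Psi root : C -> C) (z2 : C) : C :=
  cayley (Psi (root (cayley_inv z2))).

Definition branch_contact_order (psi : C -> C) (K : nat) : Prop :=
  ~~ odd K /\
  comparable_near1 (fun zeta => 1 - `|psi zeta|) (fun zeta => `|1 - zeta| ^+ K).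

(* K is the contact order at (1,1), with respect to the first variable, of the
   zero set of f, a polynomial function of degree at most m in the first
   variable and at most n in the second one.  The branches are indexed by pairs
   of a factor k and a branch j of the root of order [pf_deg F k]. *)
Definition contact_order (m n : nat) (f : C * C -> C) (K : nat) : Prop :=
  exists (F : puiseux_factorization (cayley_pullback m n f))
         (r : forall k, 'I_(pf_deg F k) -> C -> C)
         (Kb : forall k, 'I_(pf_deg F k) -> nat),
    [/\ forall k, root_branches (@r k),
        forall k j, branch_contact_order (branch (pf_series F k) (@r k j)) (@Kb k j) &
        K = (\max_(k < pf_size F) \max_(j < pf_deg F k) @Kb k j)%N].

Definition z1_contact_order (m n : nat) (p : {poly {poly C}}) (K : nat) : Prop :=
  contact_order m n (ev (reflection m n p)) K.

Definition z2_contact_order (m n : nat) (p : {poly {poly C}}) (K : nat) : Prop :=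
  contact_order n m (fun z => ev (reflection m n p) (z.2, z.1)) K.

End Definitions.

(* Main.v *)
Require Import Defs.
From HB Require Import structures.
From mathcomp Require Import all_boot all_order all_algebra.
From mathcomp Require Import all_classical all_reals all_analysis.
From mathcomp.real_closed Require Import complex.
From mathcomp Require Import ring lra.

(* In the coordinates [w] of the half-plane, [q] has no zero with both
   coordinates in the lower half-plane.  Write a branch as [w1 = Psi s],
   [w2 = s ^+ N] with [Psi s ~ c s ^+ M].  If [M] differed from [N], or if [Re c]
   were nonnegative, some ray of values of [s] would put both coordinates in the
   lower half-plane; hence [M = N] and [Re c < 0].  Take a branch with contact
   order [K] and a point with [w2 = x > 0], so that [0 <= Im w1 = O(x ^+ K)].
   Multiplying [s] by [1 + i eta] makes [Im w1] decrease at a rate comparable to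
   [x eta], so by the intermediate value theorem it vanishes for some
   [eta = O(x ^+ (K - 1))].  There [w1 = y] is real, of size at least a multiple
   of [x], and [Im w2 = O(|y| ^+ K)].  This zero lies on a branch in the other
   variable, so some contact order of the second kind is at least [K]; the
   converse inequality follows by exchanging the variables. *)

Set Implicit Arguments.
Unset Strict Implicit.
Unset Printing Implicit Defensive.

Import Order.TTheory GRing.Theory Num.Theory.
Import numFieldNormedType.Exports.

Local Open Scope classical_set_scope.
Local Open Scope ring_scope.

(** * A real-valued modulus on the complex numbers, and balls around the origin *)

Section Modulus.
Context {R : realType}.
Local Notation C := (Cplx R).
Implicit Types z w : C.

(** The norm of [C] takes its values in [C], whose order is partial; estimates are carried out with
    its real part, in the ordered field [R]. *)
Definition cmod z : R := complex.Re `|z|.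
Definition toC (x : R) : C := (x%:C)%C.

Lemma normE z : `|z| = toC (cmod z).
Proof.
have /complex_realP[k E] : (`|z| : C) \is Num.real by rewrite normr_real.
by rewrite /cmod E.
Qed.

Lemma ler_toC x y : (toC x <= toC y) = (x <= y).
Proof. exact: lecR. Qed.

Lemma ltr_toC x y : (toC x < toC y) = (x < y).
Proof. exact: ltcR. Qed.

Lemma toC_inj : injective toC.
Proof. exact: complexI. Qed.

Lemma toCD x y : toC (x + y) = toC x + toC y.
Proof. exact: (rmorphD (real_complex R)). Qed.

Lemma toCM x y : toC (x * y) = toC x * toC y.
Proof. exact: (rmorphM (real_complex R)). Qed.

Lemma toCX x n : toC (x ^+ n) = toC x ^+ n.
Proof. exact: (rmorphXn (real_complex R)). Qed.

Lemma toCN x : toC (- x) = - toC x.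
Proof. exact: (rmorphN (real_complex R)). Qed.

Lemma gt0_toC (e : C) : 0 < e -> exists2 r : R, 0 < r & e = toC r.
Proof.
move=> e0; have /complex_realP[k E] : e \is Num.real by rewrite gtr0_real.
by exists k => //; rewrite -ltr_toC -[toC k]E.
Qed.

Lemma cmod_ge0 z : 0 <= cmod z.
Proof. by rewrite -ler_toC -normE normr_ge0. Qed.

Lemma cmodM z w : cmod (z * w) = cmod z * cmod w.
Proof. by apply: toC_inj; rewrite toCM -!normE normrM. Qed.

Lemma cmodV z : cmod z^-1 = (cmod z)^-1.
Proof.
apply: toC_inj; rewrite -normE normfV normE.
exact: (esym (fmorphV (real_complex R) _)).
Qed.

Lemma cmodX z n : cmod (z ^+ n) = cmod z ^+ n.
Proof. by apply: toC_inj; rewrite toCX -!normE normrX. Qed.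

Lemma cmodN z : cmod (- z) = cmod z.
Proof. by rewrite /cmod normrN. Qed.

Lemma cmodD z w : cmod (z + w) <= cmod z + cmod w.
Proof. by rewrite -ler_toC toCD -!normE ler_normD. Qed.

Lemma cmodB z w : cmod (z - w) <= cmod z + cmod w.
Proof. by rewrite -(cmodN w) cmodD. Qed.

Lemma cmod_le z w : cmod z <= cmod w + cmod (z - w).
Proof. by rewrite -{1}(subrK w z) addrC cmodD. Qed.

Lemma cmod0 : cmod 0 = 0.
Proof. by rewrite /cmod normr0. Qed.

Lemma cmod1 : cmod 1 = 1.
Proof. by rewrite /cmod normr1. Qed.

Lemma cmod_eq0 z : (cmod z == 0) = (z == 0).
Proof. by rewrite -[RHS]normr_eq0 normE -(inj_eq toC_inj). Qed.

Lemma cmod_gt0 z : (0 < cmod z) = (z != 0).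
Proof. by rewrite lt_def cmod_ge0 andbT cmod_eq0. Qed.

Lemma cmod_sqr z : cmod z ^+ 2 = complex.Re z ^+ 2 + complex.Im z ^+ 2.
Proof. by apply: toC_inj; rewrite toCX -normE; exact: esym (add_Re2_Im2 z). Qed.

Lemma cmod_toC x : cmod (toC x) = `|x|.
Proof.
apply: (@pexpIrn _ 2); rewrite ?nnegrE ?cmod_ge0 //.
by rewrite cmod_sqr /= expr0n addr0 real_normK ?num_real.
Qed.

Lemma Re_le_cmod z : `|complex.Re z| <= cmod z.
Proof.
rewrite -(@ler_pXn2r _ 2) ?nnegrE ?cmod_ge0 // cmod_sqr real_normK ?num_real //.
by rewrite lerDl sqr_ge0.
Qed.

Lemma Im_le_cmod z : `|complex.Im z| <= cmod z.
Proof.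
rewrite -(@ler_pXn2r _ 2) ?nnegrE ?cmod_ge0 // cmod_sqr real_normK ?num_real //.
by rewrite lerDr sqr_ge0.
Qed.

Lemma cReD z w : complex.Re (z + w) = complex.Re z + complex.Re w.
Proof. by case: z => ? ?; case: w. Qed.
Lemma cImD z w : complex.Im (z + w) = complex.Im z + complex.Im w.
Proof. by case: z => ? ?; case: w. Qed.
Lemma cReN z : complex.Re (- z) = - complex.Re z.
Proof. by case: z. Qed.
Lemma cImN z : complex.Im (- z) = - complex.Im z.
Proof. by case: z. Qed.
Lemma cReM z w : complex.Re (z * w) =
  complex.Re z * complex.Re w - complex.Im z * complex.Im w.
Proof. by case: z => ? ?; case: w. Qed.
Lemma cImM z w : complex.Im (z * w) =
  complex.Re z * complex.Im w + complex.Im z * complex.Re w.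
Proof. by case: z => ? ?; case: w. Qed.
Lemma iE : 'i = Complex 0 1 :> C.
Proof. by rewrite -[LHS]/('i : R[i]) -complexiE. Qed.

Lemma near0P (P : C -> Prop) :
  (\forall z \near (0 : C), P z) <->
  exists2 e : R, 0 < e & forall z, cmod z < e -> P z.
Proof.
split=> [/nbhs_normP[e /= /gt0_toC[r r0 ->] He]|[e e0 He]].
  exists r => // z zr; apply: He.
  by rewrite /= sub0r normrN normE ltr_toC.
apply/nbhs_normP; exists (toC e); first by rewrite /= ltr_toC.
by move=> z; rewrite /= sub0r normrN normE ltr_toC; exact: He.
Qed.

Lemma near00P (P : C * C -> Prop) :
  (\forall u \near (0 : C, 0 : C), P u) <->
  exists2 e : R, 0 < e &
    forall u : C * C, cmod u.1 < e -> cmod u.2 < e -> P u.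
Proof.
split=> [[[A B] /= [/near0P[a a0 Ha] /near0P[b b0 Hb]] AB]|[e e0 He]].
  exists (Num.min a b); first by rewrite lt_min a0.
  move=> u; rewrite !lt_min => /andP[? _] /andP[_ ?].
  by apply: AB; split; [exact: Ha|exact: Hb].
exists ([set z | cmod z < e], [set z | cmod z < e]).
  by split; apply/near0P; exists e.
by move=> u [] /=; exact: He.
Qed.

End Modulus.

(** * The Cayley transform near the real axis *)

Section Cayley.
Context {R : realType}.
Local Notation C := (Cplx R).
Implicit Types z w : C.
Local Notation Re := (@complex.Re R).
Local Notation Im := (@complex.Im R).

Lemma cayley_den_neq0 w : -1 < Im w -> 1 - 'i * w != 0.
Proof.
case: w => a b /= b1; rewrite iE; apply/eqP => /(congr1 Re) /=; lra.
Qed.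

Lemma cayleyK w : -1 < Im w -> cayley_inv (cayley w) = w.
Proof.
move=> /cayley_den_neq0 d0; rewrite /cayley /cayley_inv.
have i2 : 'i * 'i = -1 :> C by rewrite -expr2 sqrCi.
have -> : (1 - (1 + 'i * w) / (1 - 'i * w)) / (1 + (1 + 'i * w) / (1 - 'i * w)) = - ('i * w).
  field; rewrite d0 /= addrCA subrK. 
  by rewrite -[1+1]/(2%:R) pnatr_eq0.
by rewrite mulrN mulrA i2 mulN1r opprK.
Qed.

(** Comes from [|1 - iw|^2 - |1 + iw|^2 = 4 Im w]. It converts the distance from [cayley w] to the
    circle into the height of [w] above the real axis. *)
Lemma cayley_cmod w : -1 < Im w ->
  (1 - cmod (cayley w)) * (1 + cmod (cayley w)) * cmod (1 - 'i * w) ^+ 2 =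
  4 * Im w.
Proof.
move=> /cayley_den_neq0; rewrite -cmod_gt0 => d0.
rewrite /cayley cmodM cmodV.
transitivity (cmod (1 - 'i * w) ^+ 2 - cmod (1 + 'i * w) ^+ 2).
  by field; rewrite gt_eqF.
by rewrite !cmod_sqr; case: w d0 => a b _; rewrite iE /=; ring.
Qed.

Lemma cayley0 : cayley 0 = 1 :> C.
Proof. by rewrite /cayley mulr0 subr0 addr0 divr1. Qed.

Lemma cmod_cayley_gt1 w : -1 < Im w -> Im w < 0 -> 1 < cmod (cayley w).
Proof.
move=> h v0; have E := cayley_cmod h.
have d0 : 0 < cmod (1 - 'i * w) by rewrite cmod_gt0 cayley_den_neq0.
rewrite ltNge; apply/negP => b1.
suff: 0 <= 4 * Im w by lra.
rewrite -E mulr_ge0 ?sqr_ge0 // mulr_ge0 ?subr_ge0 //.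
by rewrite addr_ge0 ?cmod_ge0.
Qed.

Lemma cayley_circle (y : R) : circle (cayley (toC y)).
Proof.
rewrite /circle /= normE; congr toC.
have h : -1 < Im (toC y) by rewrite /= ltrN10.
have /eqP := cayley_cmod h; rewrite /= mulr0 mulf_eq0 expf_eq0 /= cmod_eq0.
rewrite (negbTE (cayley_den_neq0 h)) orbF mulf_eq0 => /orP[/eqP|/eqP]; first lra.
have := cmod_ge0 (cayley (toC y)); lra.
Qed.

Lemma Im_le_cayley w (B : R) : cmod w < 1/4 -> 0 <= B ->
  1 - cmod (cayley w) <= B -> Im w <= B.
Proof.
move=> w1 B0 cB; case: (leP (Im w) 0) => [/le_trans->//|v0].
have h : -1 < Im w by lra.
have E := cayley_cmod h.
have Ec := cmod_ge0 (cayley w).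
have i1 : cmod ('i : C) = 1 by rewrite /cmod normCi.
have dle := cmodB 1 ('i * w); rewrite cmod1 cmodM i1 mul1r in dle.
have d0 := cmod_ge0 (1 - 'i * w).
have d2 : cmod (1 - 'i * w) ^+ 2 <= 2 by nra.
have d2' := sqr_ge0 (cmod (1 - 'i * w)).
set d := _ ^+ 2 in E d2 d2'; set c := cmod (cayley w) in E Ec cB *.
case: (ltP 1 c) => c1.
  have : (c - 1) * (1 + c) * d >= 0 by rewrite mulr_ge0 // mulr_ge0; lra.
  nra.
(* The factors [1 + c] and [d] are each at most [2], which cancels the [4] of the identity. *)
have : (1 - c) * (1 + c) * d <= (1 - c) * 2 * 2.
  apply: ler_pM => //; try lra; first by rewrite mulr_ge0; lra.
  by apply: ler_pM; lra.
lra.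
Qed.

Lemma cayley_le_Im w (T : R) : cmod w < 1/4 -> 0 <= T -> Im w <= T ->
  1 - cmod (cayley w) <= 4 * T.
Proof.
move=> w1 T0 vT; have := Im_le_cmod w; rewrite ler_norml => /andP[hl hr].
have h : -1 < Im w by lra.
have E := cayley_cmod h.
have Ec := cmod_ge0 (cayley w).
set c := cmod (cayley w) in E Ec *.
case: (ltP 1 c) => c1; first lra.
(* On the closed upper half-plane the denominator has modulus at least [1]; below it, [c <= 1]
   contradicts the identity. *)
have d1 : 1 <= cmod (1 - 'i * w) ^+ 2 \/ Im w < 0.
  case: (ltP (Im w) 0) => v0; [by right|left].
  rewrite cmod_sqr iE; case: w {w1 vT hl hr h E Ec c c1} v0 => a b /= b0.
  by nra.
case: d1 => [d1|v0]; last first.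
  have := sqr_ge0 (cmod (1 - 'i * w)) => d2.
  have : (1 - c) * (1 + c) * cmod (1 - 'i * w) ^+ 2 >= 0.
    by rewrite mulr_ge0 // mulr_ge0; lra.
  by lra.
set d := cmod (1 - 'i * w) ^+ 2 in E d1.
have : (1 - c) * 1 * 1 <= (1 - c) * (1 + c) * d.
  apply: ler_pM => //; try lra.
  by apply: ler_pM; lra.
lra.
Qed.

Lemma cayley_sub1 (y : R) : `|y| <= 1 ->
  `|y| <= cmod (1 - cayley (toC y)) <= 2 * `|y|.
Proof.
move=> y1; have h : -1 < Im (toC y) by rewrite /= ltrN10.
have i1 : cmod ('i : C) = 1 by rewrite /cmod normCi.
have d0 := cayley_den_neq0 h.
have -> : 1 - cayley (toC y) = - (2 * 'i * toC y) / (1 - 'i * toC y).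
  by rewrite /cayley; field.
rewrite cmodM cmodV cmodN !cmodM i1 mulr1 cmod_toC.
have -> : cmod (2 : C) = 2 by rewrite -[2](_ : toC 2 = _) ?cmod_toC ?ger0_norm // /toC rmorph_nat.
have dl : cmod (1 - 'i * toC y) <= 2.
  by apply: le_trans (cmodB _ _) _; rewrite cmod1 cmodM i1 cmod_toC; lra.
have dg : 1 <= cmod (1 - 'i * toC y).
  rewrite -(@ler_pXn2r _ 2) ?nnegrE ?cmod_ge0 // cmod_sqr iE /=.
  by rewrite expr1n; nra.
have y0 := normr_ge0 y.
by rewrite ler_pdivlMr ?ler_pdivrMr ?(lt_le_trans _ dg) //; apply/andP; split; nra.
Qed.

Lemma near_circle1 (P : C -> Prop) :
  (\forall zeta \near within (@circle R) (nbhs (1 : C)), P zeta) ->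
  exists2 e : R, 0 < e & forall y : R, `|y| < e -> P (cayley (toC y)).
Proof.
rewrite near_withinE => /nbhs_normP[e /= /gt0_toC[r r0 ->] He].
(* The radius is halved because [|1 - cayley y| <= 2 |y|]. *)
exists (Num.min 1 (r / 2)); first by rewrite lt_min ltr01 /= divr_gt0.
move=> y; rewrite lt_min => /andP[y1 yr]; apply: He (cayley_circle y).
have /andP[_ h] := cayley_sub1 (ltW y1).
by rewrite /= normE ltr_toC; lra.
Qed.

End Cayley.

(** * Convergent power series: Lipschitz bounds and order of vanishing *)

Section PowerSeries.
Context {R : realType}.
Local Notation C := (Cplx R).
Implicit Types (z w s t : C) (u c : nat -> C) (f : C -> C).

Lemma series_cvgP u (l : C) :
  (series u @ \oo --> l) <->
  forall e : R, 0 < e -> exists N, forall n, (N <= n)%N ->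
    cmod (l - \sum_(k < n) u k) < e.
Proof.
split=> [/cvgrPdist_lt H e e0|H].
  have /H[N _ HN] : 0 < toC e by rewrite ltr_toC.
  exists N => n /HN /=.
  by rewrite normE ltr_toC seriesEord.
apply/cvgrPdist_lt => e /gt0_toC[r /H[N HN] ->].
exists N => // n /HN; by rewrite /= normE ltr_toC seriesEord.
Qed.

Lemma cmod_sum n u : cmod (\sum_(k < n) u k) <= \sum_(k < n) cmod (u k).
Proof.
elim/big_ind2: _ => [|x1 x2 y1 y2 h1 h2|//]; first by rewrite cmod0.
exact: le_trans (cmodD _ _) (lerD h1 h2).
Qed.

Lemma series_terms_bounded u (l : C) : series u @ \oo --> l ->
  exists2 B : R, 0 < B & forall n, cmod (u n) <= B.
Proof.
move=> /series_cvgP /(_ 1 ltr01)[N HN].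
have S0 : 0 <= \sum_(k < N) cmod (u k) by apply: sumr_ge0 => k _; exact: cmod_ge0.
exists (2 + \sum_(k < N) cmod (u k)); first lra.
move=> n; case: (ltnP n N) => nN.
  rewrite (bigD1 (Ordinal nN)) //=.
  have : 0 <= \sum_(i < N | i != Ordinal nN) cmod (u i).
    by apply: sumr_ge0 => k _; exact: cmod_ge0.
  lra.
have h1 := HN _ nN; have h2 := HN _ (leqW nN).
(* A late term is a difference of two partial-sum errors, each of modulus below [1]. *)
have -> : u n = (l - \sum_(k < n) u k) - (l - \sum_(k < n.+1) u k).
  by rewrite big_ord_recr /=; ring.
by have := cmodB (l - \sum_(k < n) u k) (l - \sum_(k < n.+1) u k); lra.
Qed.

(** The mean value bound with factor [n r^(n-1)], multiplied through by [r] so that no exponent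
    [n - 1] occurs and [r = 0] needs no separate treatment. *)
Lemma cmod_subX (r : R) s t n : cmod s <= r -> cmod t <= r ->
  cmod (s ^+ n - t ^+ n) * r <= cmod (s - t) * (n%:R * r ^+ n).
Proof.
move=> sr tr; have r0 := le_trans (cmod_ge0 s) sr.
elim: n => [|n IH]; first by rewrite !expr0 subrr cmod0 !mul0r mulr0.
have -> : s ^+ n.+1 - t ^+ n.+1 = s * (s ^+ n - t ^+ n) + (s - t) * t ^+ n.
  by rewrite !exprS; ring.
have tn : cmod (t ^+ n) <= r ^+ n.
  by rewrite cmodX lerXn2r ?nnegrE ?cmod_ge0.
have := cmodD (s * (s ^+ n - t ^+ n)) ((s - t) * t ^+ n).
rewrite (cmodM s) (cmodM (s - t)) -natr1 exprSr => h.
have h1 : cmod s * cmod (s ^+ n - t ^+ n) * r <= r * (cmod (s - t) * (n%:R * r ^+ n)).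
  by rewrite -mulrA ler_pM ?mulr_ge0 ?cmod_ge0.
have h2 : cmod (s - t) * cmod (t ^+ n) * r <= cmod (s - t) * r ^+ n * r.
  by rewrite ler_wpM2r // ler_wpM2l ?cmod_ge0.
have := ler_wpM2r r0 h.
lra.
Qed.

Lemma sum_half_le n : \sum_(k < n) (1 / 2 : R) ^+ k <= 2.
Proof.
suff -> : \sum_(k < n) (1 / 2 : R) ^+ k = 2 - 2 * (1 / 2) ^+ n.
  by rewrite lerBlDr lerDl mulr_ge0 ?exprn_ge0 ?divr_ge0.
elim: n => [|n IH]; first by rewrite big_ord0 expr0 mulr1 subrr.
by rewrite big_ord_recr /= IH exprS; field.
Qed.

(** Convergence at [rho] gives [|c_k| rho^k <= B]. On the disc of radius [r = rho / 4], the [k]-th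
    terms at [s] and [t] differ by at most [|s - t| (B / r) k / 4^k]; as [k <= 2^k], these bounds
    are dominated by a geometric series of ratio [1/2] and sum [2]. *)
Lemma power_series_lipschitz c f (rho : R) : 0 < rho ->
  (forall t, cmod t <= rho -> series (fun n => c n * t ^+ n) @ \oo --> f t) ->
  exists2 L : R, 0 <= L & forall s t, cmod s <= rho / 4 -> cmod t <= rho / 4 ->
    cmod (f s - f t) <= L * cmod (s - t).
Proof.
move=> rho0 Hf; have [|B B0 HB] := @series_terms_bounded _ _ (Hf (toC rho) _).
  by rewrite cmod_toC gtr0_norm.
set r := rho / 4; have r0 : 0 < r by rewrite divr_gt0.
exists (2 * B / r); first by rewrite divr_ge0 ?mulr_ge0 ?ltW.
move=> s t sr tr.
have bnd k : cmod (c k * s ^+ k - c k * t ^+ k) <=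
             cmod (s - t) * (B / r) * (1 / 2) ^+ k.
  rewrite -mulrBr cmodM.
  have h := cmod_subX k sr tr.
  have hB := HB k; rewrite cmodM cmodX cmod_toC gtr0_norm // in hB.
  have E : rho ^+ k = r ^+ k * 4 ^+ k by rewrite -exprMn /r divfK.
  have k2 : (k%:R : R) <= 2 ^+ k by rewrite -natrX ler_nat ltnW // ltn_expl.
  have F : (4 : R) ^+ k = 2 ^+ k * 2 ^+ k by rewrite -exprMn; congr (_ ^+ _); ring.
  have t0 : 0 < (2 : R) ^+ k by rewrite exprn_gt0.
  rewrite expr_div_n expr1n.
  set X := cmod (s ^+ k - t ^+ k) in h *; set Y := cmod (s - t) in h *.
  have Y0 : 0 <= Y by exact: cmod_ge0.
  have c0 := cmod_ge0 (c k).
  have rk := exprn_gt0 k r0.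
  have -> : Y * (B / r) * (1 / 2 ^+ k) = Y * B / (r * 2 ^+ k).
    by field; rewrite !gt_eqF.
  rewrite ler_pdivlMr ?mulr_gt0 //.
  have h1 : cmod (c k) * (X * r) <= cmod (c k) * (Y * (2 ^+ k * r ^+ k)).
    rewrite ler_wpM2l // (le_trans h) //.
    by rewrite ler_wpM2l // ler_wpM2r // ltW.
  rewrite E F in hB.
  have h2 := ler_wpM2l Y0 hB.
  have h3 := ler_wpM2r (ltW t0) h1.
  lra.
(* The termwise bound passes to the limit: both values are replaced by partial sums of common length
   [n], with error [e / 2] each. *)
apply/ler_addgt0Pr => e e0.
have r4 : r <= rho by rewrite /r; lra.
have /series_cvgP /(_ (e / 2)) [|N1 H1] := Hf _ (le_trans sr r4).
  by rewrite divr_gt0.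
have /series_cvgP /(_ (e / 2)) [|N2 H2] := Hf _ (le_trans tr r4).
  by rewrite divr_gt0.
pose n := maxn N1 N2.
have {}H1 := H1 n (leq_maxl _ _); have {}H2 := H2 n (leq_maxr _ _).
set S := \sum_(k < n) _ in H1; set T := \sum_(k < n) _ in H2.
have -> : f s - f t = (f s - S) - (f t - T) + (S - T) by ring.
have h1 := cmodD ((f s - S) - (f t - T)) (S - T).
have h2 := cmodB (f s - S) (f t - T).
have h3 : cmod (S - T) <= 2 * B / r * cmod (s - t).
  rewrite /S /T -sumrB; apply: le_trans (cmod_sum n (fun k => c k * s ^+ k - c k * t ^+ k)) _.
  apply: le_trans (_ : \sum_(k < n) cmod (s - t) * (B / r) * (1 / 2) ^+ k <= _).
    by apply: ler_sum => k _; exact: bnd.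
  rewrite -mulr_sumr.
  have a0 : 0 <= cmod (s - t) * (B / r).
    by rewrite mulr_ge0 ?cmod_ge0 ?divr_ge0 ?ltW.
  have -> : 2 * B / r * cmod (s - t) = cmod (s - t) * (B / r) * 2 by ring.
  by rewrite ler_wpM2l ?sum_half_le.
apply: (le_trans h1); rewrite addrC; apply: lerD h3 _; apply: (le_trans h2).
rewrite [e]splitr; apply: lerD; apply: ltW; [exact: H1|exact: H2].
Qed.

Lemma eq_cvg_series (u v : nat -> C) (l l' : C) :
  series u @ \oo --> l -> series v @ \oo --> l' -> u =1 v -> l = l'.
Proof.
move=> hu + uv; rewrite -(funext uv) => hv.
exact: (cvg_unique (@norm_hausdorff _ _) hu hv).
Qed.

Lemma series_mulr (u : nat -> C) (l a : C) :
  series u @ \oo --> l -> series (fun n => a * u n) @ \oo --> a * l.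
Proof.
move=> /series_cvgP H; apply/series_cvgP => e e0.
have a1 : 0 < cmod a + 1 by have := cmod_ge0 a; lra.
have [N HN] := H (e / (cmod a + 1)) (divr_gt0 e0 a1); exists N => n /HN.
rewrite -mulr_sumr -mulrBr cmodM ltr_pdivlMr // => h.
by apply: le_lt_trans h; rewrite mulrC ler_wpM2l ?cmod_ge0 //; lra.
Qed.

Lemma series_shift (u : nat -> C) (l : C) M : (forall n, (n < M)%N -> u n = 0) ->
  series u @ \oo --> l -> series (fun n => u (n + M)%N) @ \oo --> l.
Proof.
move=> u0 /series_cvgP H; apply/series_cvgP => e /H[N HN]; exists N => n nN.
have := HN (n + M)%N (leq_trans nN (leq_addr _ _)).
suff -> : \sum_(k < n + M) u k = \sum_(k < n) u (k + M)%N by [].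
rewrite addnC big_split_ord /= big1 ?add0r => [|i _]; last exact: u0.
by apply: eq_bigr => i _; rewrite addnC.
Qed.

Lemma series_at0 c : series (fun n => c n * (0 : C) ^+ n) @ \oo --> c 0%N.
Proof.
apply/series_cvgP => e e0; exists 1%N => -[|n] // _.
by rewrite big_ord_recl expr0 mulr1 big1 ?addr0 ?subrr ?cmod0 // => i _; rewrite exprS mul0r mulr0.
Qed.

(* [H] is the power series [\sum_n c_(n+M) s^n], with M the order of [f]. *)
Lemma power_series_order f : convergent_power_series f ->
  (\forall s \near (0 : C), f s = 0) \/
  exists M (H : C -> C) (rho L : R), [/\ 0 < rho, 0 <= L, H 0 != 0 &
    [/\ forall s, cmod s <= rho -> f s = s ^+ M * H s,
        forall s t, cmod s <= rho -> cmod t <= rho ->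
          cmod (f s - f t) <= L * cmod (s - t) &
        forall s t, cmod s <= rho -> cmod t <= rho ->
          cmod (H s - H t) <= L * cmod (s - t)]].
Proof.
move=> [c /near0P[e e0 Hf]].
have [exc|nc] := pselect (exists n, c n != 0); last first.
  left; apply/near0P; exists e => // s /Hf /series_cvgP h.
  have c0 n : c n = 0 by apply/eqP/negPn/negP => cn; apply: nc; exists n.
  apply/eqP; rewrite -cmod_eq0; apply/eqP/le_anti; rewrite cmod_ge0 andbT.
  apply/ler_addgt0Pr => d /h[N /(_ N (leqnn _))].
  rewrite big1 ?subr0 ?add0r; first exact: ltW.
  by move=> i _; rewrite c0 mul0r.
right; case: (ex_minnP exc) => M cM minM.
have cz n : (n < M)%N -> c n = 0.
  by move=> nM; apply/eqP/negPn/negP => /minM; rewrite leqNgt nM.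
(* At [0], where the quotient is degenerate for [M > 0], the value is set to the leading
   coefficient, which is the sum of the shifted series there. *)
pose H s := if s == 0 then c M else f s / s ^+ M.
have HH s : cmod s < e -> series (fun n => c (n + M)%N * s ^+ n) @ \oo --> H s.
  move=> /Hf h; rewrite /H; case: eqP => [->|/eqP s0].
    exact: (@series_at0 (fun n => c (n + M)%N)).
  have := @series_mulr _ _ (s ^+ M)^-1 (@series_shift _ _ M _ h).
  rewrite mulrC; rewrite (_ : (fun n => _) = (fun n => c (n + M)%N * s ^+ n)).
    by apply => n nM; rewrite cz ?mul0r.
  apply/funext => n; rewrite exprD; field; exact: expf_neq0.
pose r := e / 2; have r0 : 0 < r by rewrite divr_gt0.
have re s : cmod s <= r -> cmod s < e by rewrite /r; lra.
have [L1 L10 H1] := power_series_lipschitz r0 (fun s h => Hf s (re s h)).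
have [L2 L20 H2] := power_series_lipschitz r0 (fun s h => HH s (re s h)).
have r4 : r / 4 <= r by lra.
exists M, H, (r / 4), (L1 + L2); split.
- by rewrite divr_gt0.
- by rewrite addr_ge0.
- by rewrite /H eqxx.
split=> [s sr|s t sr tr|s t sr tr].
- rewrite /H; case: eqP => [s0|/eqP s0]; last by rewrite mulrC divfK ?expf_neq0.
  have e00 : cmod (0 : C) < e by rewrite cmod0.
  rewrite s0 (eq_cvg_series (Hf 0 e00) (@series_at0 c) (fun=> erefl)).
  by case: (M) cz => [|M'] cz; rewrite ?expr0 ?mul1r // exprS !mul0r cz.
- apply: le_trans (H1 _ _ sr tr) _; apply: ler_wpM2r; first exact: cmod_ge0.
  by rewrite lerDl.
- apply: le_trans (H2 _ _ sr tr) _; apply: ler_wpM2r; first exact: cmod_ge0.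
  by rewrite lerDr.
Qed.
End PowerSeries.

(** * Points at which two monomials both lie in the lower half-plane *)

Section Sector.
Context {R : realType}.
Local Notation C := (Cplx R).
Local Notation Re := (@complex.Re R).
Local Notation Im := (@complex.Im R).

Lemma expiX (t : R) n : expi t ^+ n = expi (n%:R * t) :> C.
Proof.
elim: n => [|n IH]; first by rewrite expr0 mul0r /expi cos0 sin0.
rewrite exprS IH -natr1 mulrDl mul1r addrC /expi cosD sinD.
by apply/eqP; rewrite eq_complex /=; apply/andP; split; apply/eqP; ring.
Qed.

(** The admissible [t] form an open interval longer than a half-period of the sinusoid, so it
    becomes negative there. An endpoint [pi / 2] or [- pi / 2] of the half-period works unless
    [p = 0]. *)
Lemma opposite_half_plane (p q A : R) (N : nat) : (0 < N)%N -> N%:R + 1 <= A ->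
  (p != 0) || (q != 0) ->
  exists2 t, `|t| * N%:R < A * (pi / 2) & p * sin t + q * cos t < 0.
Proof.
move=> N0 NA pq; have pi0 := pi_gt0 R.
have Np : 0 < N%:R :> R by rewrite ltr0n.
have hp : N%:R * (pi / 2) < A * (pi / 2) by rewrite ltr_pM2r ?divr_gt0 //; lra.
have npi2 : `|pi / 2 : R| = pi / 2 by rewrite gtr0_norm ?divr_gt0.
case: (ltrgtP p 0) pq => [p0 _|p0 _|-> /= q0].
- exists (pi / 2); first by rewrite npi2 mulrC.
  by rewrite sin_pihalf cos_pihalf mulr1 mulr0 addr0.
- exists (- (pi / 2)); first by rewrite normrN npi2 mulrC.
  by rewrite sinN cosN sin_pihalf cos_pihalf mulrN1 mulr0 addr0 oppr_lt0.
case: (ltrgtP q 0) q0 => // q0 _.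
  by exists 0; rewrite ?normr0 ?cos0 ?sin0 ?mul0r ?mulr_gt0 ?divr_gt0 //; lra.
have d0 : 0 < pi / (4 * N%:R) :> R by rewrite divr_gt0 ?mulr_gt0.
(* Here [t] must go strictly past [pi / 2]; the excess costs [pi / 4] after multiplication by [N],
   and [A >= N + 1] leaves room for [pi / 2]. *)
exists (pi / (4 * N%:R) + pi / 2).
  rewrite gtr0_norm; last by rewrite addr_gt0 // divr_gt0.
  rewrite mulrDl (_ : pi / (4 * N%:R) * N%:R = pi / 4); last by field; rewrite gt_eqF.
  have : (N%:R + 1) * (pi / 2) <= A * (pi / 2) by rewrite ler_pM2r ?divr_gt0.
  by lra.
rewrite cosDpihalf mul0r add0r mulrN oppr_lt0 mulr_gt0 // sin_gt0_pi // d0 /=.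
rewrite ltr_pdivrMr ?mulr_gt0 // ltr_pMr //.
have : 1 <= N%:R :> R by rewrite ler1n.
lra.
Qed.

(* The values of [u ^+ M] sweep more than a half-turn while [a * u ^+ N]
   describes the lower half-plane. *)
Lemma lower_powers_neq (N M : nat) (a b : C) : (0 < N)%N -> (N < M)%N ->
  a != 0 -> b != 0 -> exists2 u : C, Im (a * u ^+ N) < 0 & Im (b * u ^+ M) < 0.
Proof.
move=> N0 NM a0 b0.
have i0 : 'i != 0 :> C by exact: neq0Ci.
(* The base point puts [a * u0 ^+ N] at [-i], on the axis of the lower half-plane. *)
pose u0 : C := N.-root (- 'i / a).
have u0N : a * u0 ^+ N = - 'i by rewrite /u0 rootCK // mulrC divfK.
have u00 : u0 != 0.
  apply/eqP => E; move/eqP: u0N; rewrite E expr0n gtn_eqF // mulr0.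
  by rewrite eq_sym oppr_eq0 (negbTE i0).
pose b' := b * u0 ^+ M.
have : b' != 0 by rewrite mulf_neq0 ?expf_neq0.
have -> : (b' != 0) = (Re b' != 0) || (Im b' != 0).
  by rewrite -negb_and; case: (b') => x y; rewrite eq_complex.
have NM1 : N%:R + 1 <= M%:R :> R by rewrite natr1 ler_nat.
move=> /(opposite_half_plane N0 NM1)[t tlt tneg].
have M0 : 0 < M%:R :> R by rewrite ltr0n (leq_ltn_trans _ NM).
(* This rotation turns [b * u ^+ M] by the full angle [t], but [a * u ^+ N] only by [N t / M], less
   than a quarter-turn away from [-i]. *)
exists (u0 * expi (t / M%:R)).
  rewrite exprMn mulrA u0N expiX iE mulNr cImN cImM /= mul0r add0r mul1r oppr_lt0.
  rewrite cos_gt0_pihalf // -ltr_norml !normrM normfV !normr_nat.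
  by rewrite mulrA ltr_pdivrMr // mulrC [ltRHS]mulrC.
rewrite exprMn mulrA -/b' expiX mulrCA divff ?gt_eqF // mulr1 cImM /= [Im b' * _]mulrC.
by rewrite [Im b' * _]mulrC in tneg *; lra.
Qed.

Lemma lower_powers_eq (N : nat) (c : C) : (0 < N)%N -> c != 0 -> 0 <= Re c ->
  exists2 u : C, Im (u ^+ N) < 0 & Im (c * u ^+ N) < 0.
Proof.
case: c => x y N0 c0 /= x0.
(* As [u ^+ N] is arbitrary, take [v = - i conj(c) - i]: then [Im v = - Re c - 1] and
   [Im (c v) = - |c|^2 - Re c]. *)
exists (N.-root (Complex (- y) (- x - 1)) : C); rewrite rootCK //=; first lra.
have : (x != 0) || (y != 0) by rewrite -negb_and; move: c0; rewrite eq_complex.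
case: (ltrgtP x 0) x0 => //= [x0 _ _|-> _]; first nra.
move=> y0; have : 0 < y ^+ 2 by rewrite exprn_even_gt0.
by lra.
Qed.

Lemma lower_powers (N M : nat) (c : C) : (0 < N)%N -> (0 < M)%N -> c != 0 ->
  (forall u : C, Im (u ^+ N) < 0 -> Im (c * u ^+ M) < 0 -> False) ->
  M = N /\ Re c < 0.
Proof.
move=> N0 M0 c0 H; case: (ltngtP M N) => [MN|NM|MN].
- have [u h1 h2] := lower_powers_neq M0 MN c0 (oner_neq0 C).
  by case: (H u) => //; rewrite mul1r in h2.
- have [u h1 h2] := lower_powers_neq N0 NM (oner_neq0 C) c0.
  by case: (H u) => //; rewrite mul1r in h1.
split=> //; rewrite ltNge; apply/negP => /(lower_powers_eq N0 c0)[u h1 h2].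
by apply: (H u); rewrite ?MN.
Qed.

End Sector.

(** * The leading term of a branch, and nearby points where its value is real *)

Section Germ.
Context {R : realType}.
Local Notation C := (Cplx R).
Local Notation Re := (@complex.Re R).
Local Notation Im := (@complex.Im R).

Lemma cImZ (x : R) (z : C) : Im (toC x * z) = x * Im z.
Proof. by rewrite cImM /= mul0r addr0. Qed.

Lemma root_lt (x r : R) (n : nat) : 0 <= r -> x ^+ n < r ^+ n -> x < r.
Proof.
move=> r0 xr; rewrite ltNge; apply/negP => rx.
by move: xr; rewrite ltNge lerXn2r ?nnegrE // (le_trans r0).
Qed.

(** Scaling [u] by a small positive [eps] preserves the signs of the homogeneous terms, while
    replacing [H s] by [H 0] costs one more power of [eps]. Hence a forbidden [u] for the leading
    monomials yields a forbidden [s] for [Psi]. *)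
Lemma leading_term_sign (N M : nat) (Psi H : C -> C) (rho L e : R) :
  (0 < N)%N -> (0 < M)%N -> 0 < rho -> 0 <= L -> 0 < e -> H 0 != 0 ->
  (forall s, cmod s <= rho -> Psi s = s ^+ M * H s) ->
  (forall s t, cmod s <= rho -> cmod t <= rho ->
    cmod (H s - H t) <= L * cmod (s - t)) ->
  (forall s, cmod s < e -> Im (s ^+ N) < 0 -> Im (Psi s) < 0 -> False) ->
  M = N /\ Re (H 0) < 0.
Proof.
move=> N0 M0 rho0 L0 e0 H00 HPsi HL Hno.
apply: lower_powers => // u uN uM.
set U := cmod u; have U0 : 0 <= U by exact: cmod_ge0.
set d := - Im (H 0 * u ^+ M); have d0 : 0 < d by rewrite oppr_gt0.
pose A := U ^+ M * L * U.
have A0 : 0 <= A by rewrite !mulr_ge0 ?exprn_ge0.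
(* The first bound keeps [eps * u] in both discs; the second makes the error [eps * A] smaller than
   the margin [d]. Adding [1] keeps the denominators positive. *)
pose eps := Num.min (Num.min rho (e / 2) / (U + 1)) (d / (A + 1)).
have eps0 : 0 < eps.
  by rewrite lt_min !divr_gt0 ?lt_min ?rho0 ?divr_gt0 //; lra.
have U1 : 0 < U + 1 by lra.
have A1 : 0 < A + 1 by lra.
have : eps <= eps by [].
rewrite {2}/eps le_min !ler_pdivlMr // le_min => /andP[/andP[er ee] ed].
have cs : cmod (toC eps * u) = eps * U by rewrite cmodM cmod_toC gtr0_norm.
have sr : cmod (toC eps * u) <= rho by rewrite cs; nra.
apply: (Hno (toC eps * u)).
- by rewrite cs; nra.
- by rewrite exprMn -toCX cImZ pmulr_rlt0 ?exprn_gt0.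
rewrite HPsi // exprMn -toCX -mulrA cImZ pmulr_rlt0 ?exprn_gt0 //.
set s := toC eps * u in cs sr *.
have -> : u ^+ M * H s = H 0 * u ^+ M + u ^+ M * (H s - H 0) by ring.
rewrite cImD.
have h1 := le_trans (ler_norm _) (Im_le_cmod (u ^+ M * (H s - H 0))).
rewrite cmodM cmodX -/U in h1.
have h2 : U ^+ M * cmod (H s - H 0) <= U ^+ M * (L * (eps * U)).
  have := HL s 0 sr; rewrite cmod0 subr0 cs => /(_ (ltW rho0)).
  by apply: ler_wpM2l; exact: exprn_ge0.
have h3 : U ^+ M * (L * (eps * U)) = eps * A by rewrite /A; ring.
have h4 : Im (H 0 * u ^+ M) = - d by rewrite opprK.
rewrite h4; move: h1 h2; rewrite h3; lra.
Qed.

Lemma expr1D_remainder (N : nat) : exists2 B : R, 0 <= B &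
  forall z : C, cmod z <= 1 ->
    cmod ((1 + z) ^+ N - 1 - toC N%:R * z) <= B * cmod z ^+ 2.
Proof.
elim: N => [|N [B B0 HB]].
  exists 0 => // z _.
  by rewrite expr0 subrr (_ : toC 0%:R = 0) // mul0r subrr cmod0 mul0r.
(* The old remainder is multiplied by [1 + z], of modulus at most [2], and the new cross term is
   [N z^2]. *)
exists (2 * B + N%:R); first by rewrite addr_ge0 // mulr_ge0.
move=> z z1.
have -> : (1 + z) ^+ N.+1 - 1 - toC N.+1%:R * z =
    (1 + z) * ((1 + z) ^+ N - 1 - toC N%:R * z) + toC N%:R * z ^+ 2.
  by rewrite -natr1 toCD (_ : toC 1 = 1) // exprS; ring.
apply: le_trans (cmodD _ _) _.
rewrite (cmodM (1 + z)) (cmodM (toC _)) cmodX cmod_toC normr_nat mulrDl lerD //.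
rewrite -mulrA ler_pM ?cmod_ge0 ?HB //.
by apply: le_trans (cmodD _ _) _; rewrite cmod1; lra.
Qed.

Lemma lipschitz_continuous_itv (f : R -> R) (a b L : R) :
  (forall x y, a <= x <= b -> a <= y <= b -> `|f x - f y| <= L * `|x - y|) ->
  {within `[a, b], continuous f}.
Proof.
move=> fL; apply/subspace_continuousP => x /=; rewrite in_itv /= => xab.
apply/cvgrPdist_lt => e e0; rewrite near_withinE; apply/nbhs_normP.
have L0 : 0 < `|L| + 1 by rewrite ltr_pwDr.
exists (e / (`|L| + 1)); first by rewrite /= divr_gt0.
move=> y /=; rewrite ltr_pdivlMr // in_itv /= => xy yab.
apply: le_lt_trans (fL _ _ xab yab) _; apply: le_lt_trans xy.
rewrite mulrC ler_wpM2l //; have := ler_norm L; lra.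
Qed.

(* Multiplying [s0] by [1 + i eta] moves the zero so that [Im (Psi s)] changes
   at the rate [x * N * Re (H 0) < 0]; it vanishes for some [eta] of size
   [x ^ (K - 1)]. *)
Lemma real_value_near (N K : nat) (Psi H : C -> C) (rho L B : R) :
  (0 < N)%N -> 0 < rho -> 0 <= L -> 0 < B ->
  (forall s, cmod s <= rho -> Psi s = s ^+ N * H s) ->
  (forall s t, cmod s <= rho -> cmod t <= rho ->
    cmod (Psi s - Psi t) <= L * cmod (s - t)) ->
  (forall s t, cmod s <= rho -> cmod t <= rho ->
    cmod (H s - H t) <= L * cmod (s - t)) ->
  Re (H 0) < 0 ->
  exists D m delta : R, [/\ 0 < D, 0 < m, 0 < delta &
    forall s0 x, 0 < x < delta -> s0 ^+ N = toC x ->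
      0 <= Im (Psi s0) <= B * x ^+ K.+2 ->
    exists s, [/\ cmod s <= 2 * cmod s0, Im (Psi s) = 0,
      cmod (s ^+ N - toC x) <= D * x ^+ K.+2 & m * x <= cmod (Psi s)]].
Proof.
move=> N0 rho0 L0 B0 HPsi LPsi LH H0.
have [Q Q0 HQ] := expr1D_remainder N.
set h := - Re (H 0); have h0 : 0 < h by rewrite oppr_gt0.
have N1 : 1 <= N%:R :> R by rewrite ler1n.
pose Hm := cmod (H 0) + h.
have Hm0 : 0 < Hm by rewrite ltr_wpDl ?cmod_ge0.
(* Chosen so that at [eta = E = D1 x^(K+1)] the guaranteed decrease [x eta h / 4] equals
   [B x^(K+2)], the largest possible initial height. *)
pose D1 := 4 * B / h; have D10 : 0 < D1 by rewrite divr_gt0 ?mulr_gt0.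
(* Bounding [|s0|] by [r1] keeps the disc of radius [2 |s0|] within radius [rho] and limits the
   variation of [H] on it to [h / 4]. *)
pose r1 := Num.min (Num.min 1 (rho / 2)) (h / (8 * (L + 1))).
have L1 : 0 < 8 * (L + 1) by lra.
have r10 : 0 < r1 by rewrite !lt_min ltr01 !divr_gt0.
(* For [eta <= e1] the quadratic remainder, of size [Q eta^2 Hm], is at most [eta h / 8]. *)
pose e1 := Num.min 1 (h / (8 * (Q * Hm + 1))).
have Q1 : 0 < 8 * (Q * Hm + 1).
  by rewrite mulr_gt0 // ltr_wpDl // mulr_ge0 // ltW.
have e10 : 0 < e1 by rewrite lt_min ltr01 divr_gt0.
exists ((N%:R + Q) * D1), (h / 2), (Num.min (Num.min 1 (r1 ^+ N)) (e1 / D1)).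
split.
- by apply: mulr_gt0 => //; lra.
- by rewrite divr_gt0.
- by rewrite !lt_min ltr01 exprn_gt0 // divr_gt0.
move=> s0 x /andP[x0]; rewrite !lt_min ltr_pdivlMr // -andbA => /and3P[x1 xr xe] s0x /andP[I0 IB].
set r := cmod s0; have r0 : 0 <= r by exact: cmod_ge0.
have rN : r ^+ N = x by rewrite -cmodX s0x cmod_toC gtr0_norm.
have : r <= r1 by rewrite ltW // (@root_lt _ _ N) // ?rN // ltW.
rewrite !le_min !ler_pdivlMr // -andbA => /and3P[r1' rr rh].
set E := D1 * x ^+ K.+1.
have xK : x ^+ K.+1 <= x.
  by rewrite exprS ger_pMr // exprn_ile1 // ltW.
have E0 : 0 <= E by rewrite mulr_ge0 ?exprn_ge0 ?ltW.
have : E <= e1.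
  by apply: le_trans (ltW xe); rewrite mulrC /E ler_wpM2l // ltW.
rewrite le_min ler_pdivlMr // => /andP[E1 Eh].
pose z (eta : R) : C := toC eta * 'i.
have zE (eta : R) : 0 <= eta -> cmod (z eta) = eta.
  move=> eta0; rewrite cmodM cmod_toC ger0_norm //.
  by rewrite (_ : cmod 'i = 1) ?mulr1 // /cmod normCi.
pose s eta := s0 * (1 + z eta).
have sB eta eta' : s eta - s eta' = s0 * 'i * toC (eta - eta').
  by rewrite /s /z toCD toCN; ring.
have sdist eta eta' : cmod (s eta - s eta') = r * `|eta - eta'|.
  rewrite sB !cmodM cmod_toC (_ : cmod 'i = 1) ?mulr1 //.
  by rewrite /cmod normCi.
have s2 (eta : R) : 0 <= eta <= E -> cmod (s eta) <= 2 * r.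
  case/andP=> e0 eE; rewrite /s cmodM mulrC ler_wpM2r //.
  by apply: le_trans (cmodD _ _) _; rewrite cmod1 zE //; lra.
have srho (eta : R) : 0 <= eta <= E -> cmod (s eta) <= rho.
  by move=> /s2 /le_trans; apply; lra.
have s00 : s 0 = s0 by rewrite /s /z mul0r addr0 mulr1.
have E00 : (0 : R) <= 0 <= E by rewrite lexx E0.
have HsH0 (eta : R) : 0 <= eta <= E -> cmod (H (s eta) - H 0) <= h / 4.
  move=> he; have := LH _ 0 (srho _ he); rewrite cmod0 subr0 => /(_ (ltW rho0)).
  move/le_trans; apply; apply: le_trans (ler_wpM2l L0 (s2 _ he)) _.
  by move: rh r0; clear; lra.
have ReH (eta : R) : 0 <= eta <= E -> Re (H (s eta)) <= - (h / 2).
  move=> /HsH0 he; have := le_trans (Re_le_cmod _) he.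
  by rewrite cReD cReN -/h ler_norml => /andP[_]; move: h0; lra.
have cH (eta : R) : 0 <= eta <= E -> cmod (H (s eta)) <= Hm.
  by move=> /HsH0 he; have := cmod_le (H (s eta)) (H 0); rewrite /Hm; lra.
have remN (eta : R) : 0 <= eta <= E ->
    cmod ((1 + z eta) ^+ N - 1 - toC N%:R * z eta) <= Q * eta ^+ 2.
  by case/andP=> e0 eE; rewrite -[X in X ^+ 2]zE //; apply: HQ; rewrite zE //; lra.
(* After division by [x], the linear term contributes at most [- eta h / 2], since [Re H <= - h / 2]
   and [N >= 1]; the variation of [H] and the quadratic remainder cost at most [eta h / 8] each. *)
have drop (eta : R) : 0 <= eta <= E ->
    Im (Psi (s eta)) <= Im (Psi s0) - x * (eta * (h / 4)).
  move=> he; have /andP[e0 eE] := he.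
  rewrite (HPsi _ (srho _ he)) HPsi; last by rewrite -s00 srho.
  rewrite {1}/s exprMn s0x -mulrA !cImZ -mulrBr ler_pM2l //.
  set Hs := H (s eta); set e := (1 + z eta) ^+ N - 1 - toC N%:R * z eta.
  have -> : (1 + z eta) ^+ N * Hs =
            H s0 + (Hs - H s0) + toC (N%:R * eta) * ('i * Hs) + e * Hs.
    by rewrite /e /z toCM; ring.
  rewrite !cImD cImZ [Im ('i * Hs)]cImM iE /= mul0r add0r mul1r.
  have h1 := le_trans (ler_norm _) (Im_le_cmod (Hs - H s0)).
  have h2 : cmod (Hs - H s0) <= L * (r * eta).
    have := LH _ _ (srho _ he) (srho _ E00).
    by rewrite sdist s00 subr0 (ger0_norm e0).
  have h3 := le_trans (ler_norm _) (Im_le_cmod (e * Hs)).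
  have h4 : cmod (e * Hs) <= Q * eta ^+ 2 * Hm.
    by rewrite cmodM ler_pM ?cmod_ge0 ?remN ?cH.
  have h5 := ReH _ he; rewrite -/Hs in h5.
  have h6 : N%:R * eta * Re Hs <= - (eta * (h / 2)).
    have a1 : 0 <= N%:R * eta by rewrite mulr_ge0.
    have := ler_wpM2l a1 h5.
    have : eta * (h / 2) <= N%:R * eta * (h / 2).
      by apply: ler_wpM2r; [lra|rewrite ler_peMl].
    by lra.
  have h7 : L * (r * eta) <= eta * (h / 8).
    rewrite mulrA mulrC; apply: ler_wpM2l => //.
    by move: rh r0; clear; lra.
  have h8 : Q * eta ^+ 2 * Hm <= eta * (h / 8).
    have -> : Q * eta ^+ 2 * Hm = eta * (eta * (Q * Hm)) by ring.
    apply: ler_wpM2l => //.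
    have q0 : 0 <= Q * Hm by rewrite mulr_ge0 // ltW.
    by move: (ler_wpM2r q0 eE) Eh E0; clear; lra.
  move: h1 h2 h3 h4 h6 h7 h8; rewrite cImD cImN.
  move: (Im Hs) (Im (H s0)) (Im (e * Hs)) (cmod _) (cmod _) (_ * Re Hs) => a1 a2 a3 a4 a5 a6.
  move: (L * _) (Q * _ * _) => a7 a8; lra.
have Icont : {within `[0, E], continuous (fun eta => Im (Psi (s eta)))}.
  apply: (@lipschitz_continuous_itv _ _ _ L) => a b ha hb.
  rewrite -cImN -cImD; apply: le_trans (Im_le_cmod _) _.
  apply: le_trans (LPsi _ _ (srho _ ha) (srho _ hb)) _.
  by rewrite sdist ler_wpM2l // ler_piMl.
have EE : 0 <= E <= E by rewrite E0 lexx.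
have IE : Im (Psi (s E)) <= 0.
  apply: le_trans (drop _ EE) _; rewrite subr_le0; apply: le_trans IB _.
  rewrite le_eqVlt; apply/orP; left; apply/eqP.
  by rewrite /E /D1 [x ^+ K.+2]exprS; field; rewrite gt_eqF.
have [|eta] := @IVT _ _ _ _ 0 E0 Icont.
  by rewrite s00 ge_min le_max I0 IE orbT.
rewrite in_itv /= => he IPsi; exists (s eta); split => //; first exact: s2.
  rewrite /s exprMn s0x -{2}[toC x]mulr1 -mulrBr cmodM cmod_toC gtr0_norm //.
  have /andP[e0 eE] := he.
  have -> : (1 + z eta) ^+ N - 1 = ((1 + z eta) ^+ N - 1 - toC N%:R * z eta)
     + toC N%:R * z eta by ring.
  have h1 := cmodD ((1 + z eta) ^+ N - 1 - toC N%:R * z eta) (toC N%:R * z eta).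
  rewrite [cmod (toC _ * _)]cmodM zE // cmod_toC normr_nat in h1.
  have h2 := remN _ he.
  have -> : (N%:R + Q) * D1 * x ^+ K.+2 = x * ((N%:R + Q) * E).
    by rewrite /E exprS; ring.
  rewrite ler_pM2l //; apply: le_trans h1 _.
  have h3 : Q * eta ^+ 2 <= Q * E by rewrite ler_wpM2l //; nra.
  have h4 : N%:R * eta <= N%:R * E by rewrite ler_wpM2l.
  lra.
(* The lower bound [m x] holds because [|1 + i eta| >= 1] gives [|s^N| >= x], and [|H| >= h / 2]. *)
rewrite HPsi ?srho // cmodM [h / 2 * x]mulrC; apply: ler_pM.
- exact: ltW.
- by move: h0; clear; lra.
- rewrite /s exprMn s0x cmodM cmod_toC gtr0_norm //; apply: ler_peMr; first exact: ltW.
  rewrite cmodX exprn_ege1 // (le_trans _ (Re_le_cmod _)) //.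
  by rewrite cReD /z cReM iE /= mulr0 mul0r subrr addr0 normr1.
- apply: le_trans (Re_le_cmod _); have := ReH _ he.
  by move: (Re _) => a ha; rewrite ltr0_norm; move: h0 ha; clear; lra.
Qed.

End Germ.

(** * Zeros of the pullback and comparison of the two contact orders *)

Section ContactOrder.
Context {R : realType}.
Local Notation C := (Cplx R).
Local Notation Re := (@complex.Re R).
Local Notation Im := (@complex.Im R).

(** Inversion in the circle carries both coordinates into the disk, where [p] does not vanish. *)
Lemma reflection_exterior (m n : nat) (p : {poly {poly C}}) (z : C * C) :
  has_bidegree m n p -> (forall z, bidisk z -> ev p z != 0) ->
  1 < cmod z.1 -> 1 < cmod z.2 -> ev (reflection m n p) z != 0.
Proof.
move=> bd pD h1 h2.
have z1 : z.1 != 0 by rewrite -cmod_gt0; lra.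
have z2 : z.2 != 0 by rewrite -cmod_gt0; lra.
have inv_lt1 (w : C) : 1 < cmod w -> `|(w^*)^-1| < 1.
  move=> w1; rewrite normE -[ltRHS]/(toC 1) ltr_toC cmodV /cmod norm_conjC.
  by rewrite -/(cmod w) invf_lt1 //; lra.
rewrite ev_reflection // !mulf_neq0 ?expf_neq0 // fmorph_eq0.
by apply: pD; split; exact: inv_lt1.
Qed.

(** A root missed by the [N] distinct branch values would give [X^N - w] more than [N] roots. *)
Lemma root_branches_surj (N : nat) (r : 'I_N -> C -> C) (t w : C) :
  (0 < N)%N -> root_branches r -> w != 0 -> t ^+ N = w -> exists j, r j w = t.
Proof.
move=> N0 [rN rI _] w0 tN; apply: contrapT => nt.
pose rs := t :: [seq r j w | j <- enum 'I_N].
suff : (size rs < size ('X^N - w%:P)%R)%N.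
  by rewrite size_XnsubC //= size_map size_enum_ord ltnn.
apply: max_poly_roots.
- by rewrite -size_poly_eq0 size_XnsubC.
- apply/allP => v; rewrite inE rootE !hornerE => /predU1P[->|/mapP[j _ ->]].
    by rewrite tN subrr.
  by rewrite rN subrr.
- rewrite /= map_inj_uniq ?enum_uniq ?andbT; last exact: rI.
  by apply/mapP => -[j _ E]; apply: nt; exists j.
Qed.

Lemma unit_germ_near (g : C * C -> C) : unit_germ g ->
  \forall w \near (0 : C, 0 : C), g w != 0.
Proof.
move=> [/nbhs_singleton/differentiable_continuous gc g0].
exact: cvgr_neq0 gc g0.
Qed.

Lemma puiseux_zeros (q : C * C -> C) (F : puiseux_factorization q) :
  \forall w \near (0 : C, 0 : C), q w = 0 <->
    exists (k : 'I_(pf_size F)) t, t ^+ pf_deg k = w.2 /\ w.1 = pf_series k t.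
Proof.
have zF : \forall w \near (0 : C, 0 : C), forall k : 'I_(pf_size F),
    pf_factor k w = 0 <-> exists t, t ^+ pf_deg k = w.2 /\ w.1 = pf_series k t.
  exact: (filter_forall (F := nbhs (0 : C, 0 : C)) _ (@pf_zeros _ _ F)).
near=> w.
have z : forall k : 'I_(pf_size F),
    pf_factor k w = 0 <-> exists t, t ^+ pf_deg k = w.2 /\ w.1 = pf_series k t.
  by near: w.
have u0 : pf_unit F w != 0 by near: w; exact: unit_germ_near (pf_unitP F).
have -> : q w = pf_unit F w * \prod_(k < pf_size F) pf_factor k w.
  by near: w; exact: pf_prod.
split=> [/eqP|[k /z zk]].
  rewrite mulf_eq0 (negbTE u0) => /prodf_eq0[k _ /eqP/z[t ht]].
  by exists k, t.
by rewrite (bigD1 k) //= zk mul0r mulr0.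
Unshelve. all: by end_near.
Qed.

Lemma cayley_pullback_lower (m n : nat) (f : C * C -> C) (w : C * C) :
  (forall z, 1 < cmod z.1 -> 1 < cmod z.2 -> f z != 0) ->
  -1 < Im w.1 < 0 -> -1 < Im w.2 < 0 -> cayley_pullback m n f w != 0.
Proof.
move=> f0 /andP[h1 l1] /andP[h2 l2].
rewrite /cayley_pullback !mulf_neq0 ?expf_neq0 ?cayley_den_neq0 //.
by apply: f0; exact: cmod_cayley_gt1.
Qed.

Lemma cayley_pullback_swap (m n : nat) (f : C * C -> C) (w : C * C) :
  cayley_pullback n m (fun z => f (z.2, z.1)) (w.2, w.1) =
  cayley_pullback m n f w.
Proof. by rewrite /cayley_pullback /= [(1 - 'i * w.2) ^+ n * _]mulrC. Qed.

(** Near [1] the circle is parametrized by [cayley y] with [y] real, and [|1 - cayley y|] lies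
    between [|y|] and [2 |y|]; the factor [2^K] goes into the constant. *)
Lemma branch_bounds (Psi r : C -> C) (K : nat) :
  branch_contact_order (branch Psi r) K ->
  exists c e : R, [/\ 0 < c, 0 < e & forall y : R, `|y| < e ->
    1 - cmod (cayley (Psi (r (toC y)))) <= c * `|y| ^+ K /\
    `|y| ^+ K <= c * (1 - cmod (cayley (Psi (r (toC y)))))].
Proof.
move=> [_ [_ /gt0_toC[c c0 ->] /near_circle1[e e0 He]]].
exists (c * 2 ^+ K), (Num.min e 1).
have K2 : 1 <= 2 ^+ K :> R by rewrite exprn_ege1 // ler1n.
split; [by rewrite mulr_gt0 // exprn_gt0|by rewrite lt_min e0 ltr01|].
move=> y; rewrite lt_min => /andP[/He[]]; rewrite /branch cayleyK; last first.
  by rewrite /= ltrN10.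
set v := cayley (Psi _); rewrite !normE.
rewrite -[1 - toC (cmod v)]/(toC 1 - toC (cmod v)) -toCN -toCD -toCX -!toCM !ler_toC.
move=> h1 h2 /ltW/cayley_sub1/andP[y1 y2].
have l1 : `|y| ^+ K <= cmod (1 - cayley (toC y)) ^+ K.
  by rewrite lerXn2r ?nnegrE ?cmod_ge0.
have l2 : cmod (1 - cayley (toC y)) ^+ K <= 2 ^+ K * `|y| ^+ K.
  by rewrite -exprMn lerXn2r ?nnegrE ?cmod_ge0 // mulr_ge0.
split.
  by apply: (le_trans h1); rewrite -mulrA ler_pM2l.
have v0 : 0 <= 1 - cmod v.
  by rewrite -(pmulr_rge0 _ c0); apply: le_trans h2; rewrite exprn_ge0 ?cmod_ge0.
apply: (le_trans l1); apply: (le_trans h2).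
by rewrite mulrAC ler_peMr // mulr_ge0 // ltW.
Qed.

(** On each branch [Im w] is at least a multiple of [|y|] to its own contact order. That order is
    below [K], so for small [y] any fixed multiple of [|y|^K] is exceeded; finitely many branches
    allow a common radius. *)
Lemma branches_Im_gt (m n K : nat) (f : C * C -> C)
    (F : puiseux_factorization (cayley_pullback m n f))
    (r : forall k : 'I_(pf_size F), 'I_(pf_deg k) -> C -> C)
    (Kb : forall k : 'I_(pf_size F), 'I_(pf_deg k) -> nat) (D : R) :
  (forall k, root_branches (@r k)) ->
  (forall k j, branch_contact_order (branch (pf_series k) (@r k j)) (@Kb k j)) ->
  (forall k j, (@Kb k j < K)%N) -> 0 < D ->
  exists2 e : R, 0 < e & forall (w : C) (y : R), y != 0 ->
    cmod w < e -> `|y| < e -> cayley_pullback m n f (w, toC y) = 0 ->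
    D * `|y| ^+ K < Im w.
Proof.
move=> rP KbP KbK D0.
have near_bound k j : \forall u \near (0 : C, 0 : C), forall y : R, u.2 = toC y ->
    y != 0 -> u.1 = pf_series k (r k j u.2) -> D * `|y| ^+ K < Im u.1.
  have [c [e [c0 e0 He]]] := branch_bounds (KbP k j).
  apply/near00P.
  (* The last bound gives [4 c D |y| < 1/2], which refutes [|y|^Kb <= 4 c D |y|^K] once [K > Kb]. *)
  pose d := Num.min (Num.min 1 e) (Num.min (1 / 4) (1 / (8 * c * D))).
  have cD : 0 < 8 * c * D by rewrite !mulr_gt0.
  have d0 : 0 < d by rewrite !lt_min ltr01 e0 !divr_gt0.
  exists d => // -[w1 w2] /= + + y E.
  rewrite E cmod_toC !lt_min -!andbA => /and4P[_ _ w14 _] /and4P[y1 ye _ yD] y0 w1E.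
  have [_ /=] := He y ye; rewrite -w1E => hy.
  rewrite ltNge; apply/negP => Iw.
  have y0' : 0 < `|y| by rewrite normr_gt0.
  have T0 : 0 <= D * `|y| ^+ K by rewrite mulr_ge0 ?exprn_ge0 ?ltW.
  have h := cayley_le_Im w14 T0 Iw.
  have : `|y| ^+ (Kb k j) <= c * (4 * (D * `|y| ^+ K)).
    by apply: (le_trans hy); rewrite ler_pM2l.
  have EK : K = (K - (Kb k j).+1 + Kb k j).+1 by rewrite -addnS subnK.
  have -> : `|y| ^+ K = `|y| * (`|y| ^+ (K - (Kb k j).+1) * `|y| ^+ (Kb k j)).
    by rewrite {1}EK exprS exprD.
  have a1 : `|y| ^+ (K - (Kb k j).+1) <= 1 by rewrite exprn_ile1 // ltW.
  have X0 : 0 < `|y| ^+ (Kb k j) by rewrite exprn_gt0.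
  have := exprn_ge0 (K - (Kb k j).+1) (ltW y0').
  set a := `|y| ^+ (K - _) in a1 *; set X := `|y| ^+ (Kb k j) in X0 *.
  move=> a0; have -> : c * (4 * (D * (`|y| * (a * X)))) = 4 * c * D * `|y| * a * X by ring.
  rewrite -[X in X <= _]mul1r ler_pM2r // leNgt => /negP; apply.
  rewrite ltr_pdivlMr // in yD.
  have b0 : 0 <= 4 * c * D * `|y| by rewrite !mulr_ge0 // ltW.
  have := ler_wpM2l b0 a1; lra.
have [e1 e10 H1] := (near00P _).1 (filter_forall (F := nbhs (0 : C, 0 : C)) _
  (fun k => filter_forall _ (near_bound k))).
have [e2 e20 H2] := (near00P _).1 (puiseux_zeros F).
exists (Num.min (Num.min e1 e2) 1); first by rewrite !lt_min e10 e20 ltr01.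
move=> w y y0; rewrite !lt_min -!andbA => /and3P[w1 w2 _] /and3P[y1 y2 y3].
have cy : cmod (toC y) = `|y| by exact: cmod_toC.
have y2' : cmod (w, toC y).2 < e2 by rewrite /= cy.
move=> /((H2 (w, toC y) w2 y2').1)[k [t [/= tN wE]]].
have Cy0 : toC y != 0 by rewrite -cmod_eq0 cy normr_eq0.
(* Degree [0] would force [1 = y], against [|y| < 1]. *)
have N0 : (0 < pf_deg k)%N.
  rewrite lt0n; apply/eqP => N0; move: tN; rewrite N0 expr0 => /(congr1 cmod).
  by rewrite cmod1 cy => yE; rewrite yE ltxx in y3.
have [j rj] := root_branches_surj N0 (rP k) Cy0 tN.
have y1' : cmod (w, toC y).2 < e1 by rewrite /= cy.
by apply: (H1 (w, toC y) w1 y1' k j y erefl y0); rewrite /= rj.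
Qed.

Lemma cmodX_le (s : C) (n : nat) : (0 < n)%N -> cmod s <= 1 ->
  cmod (s ^+ n) <= cmod s.
Proof.
case: n => // n _ s1; rewrite cmodX exprS ler_piMr ?cmod_ge0 //.
by rewrite exprn_ile1 ?cmod_ge0.
Qed.

(** If a branch of the first kind had contact order above [K2], all branches of the second kind
    would have smaller order, and their zeros with [w1 = y] real would lie higher than any fixed
    multiple of [|y|] to that power. The zero constructed from the chosen branch violates this. *)
Lemma contact_order_le (m n K1 K2 : nat) (f : C * C -> C) :
  (forall z, 1 < cmod z.1 -> 1 < cmod z.2 -> f z != 0) ->
  contact_order m n f K1 -> contact_order n m (fun z => f (z.2, z.1)) K2 ->
  (K1 <= K2)%N.
Proof.
move=> f0 [F1 [r1 [Kb1 [rP1 KbP1 ->]]]] [F2 [r2 [Kb2 [rP2 KbP2 K2E]]]].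
apply/bigmax_leqP => k _; apply/bigmax_leqP => j _.
rewrite leqNgt; apply/negP => K2lt.
have KbK k' j' : (Kb2 k' j' < Kb1 k j)%N.
  apply: leq_ltn_trans K2lt; rewrite K2E.
  by apply: leq_trans (leq_bigmax k'); exact: leq_bigmax.
have evenK := (KbP1 k j).1.
have [c [e0 [c0 e00 Hc]]] := branch_bounds (KbP1 k j).
have Hgt := branches_Im_gt rP2 KbP2 KbK.
(* A positive even order is at least [2]; with [K.+2], the perturbation [eta] of size [x^(K+1)]
   tends to [0] with [x]. *)
case: (Kb1 k j) (leq_ltn_trans (leq0n _) K2lt) evenK Hc Hgt => [//|[//|K]] _ _ Hc Hgt.
have rN (y : R) : r1 k j (toC y) ^+ pf_deg k = toC y by case: (rP1 k) => + _ _; apply.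
move: (r1 k j) rN Hc => r rN Hc.
have N0 : (0 < pf_deg k)%N by rewrite (leq_ltn_trans _ (ltn_ord j)).
have [Psi_cvg Psi00] := pf_seriesP k.
have [e1 e10 qzeros] := (near00P _).1 (puiseux_zeros F1).
have {qzeros} Psi_zero s : cmod (pf_series k s) < e1 -> cmod (s ^+ pf_deg k) < e1 ->
    cayley_pullback m n f (pf_series k s, s ^+ pf_deg k) = 0.
  by move=> h1 h2; apply/(qzeros (_, _)) => //; exists k, s.
move: (pf_deg k) (pf_series k) N0 rN Psi_cvg Psi00 Hc Psi_zero.
move=> N Psi N0 rN Psi_cvg Psi00 Hc Psi_zero.
have rsmall (e x : R) : 0 <= e -> `|x| < e ^+ N -> cmod (r (toC x)) < e.
  by move=> e0' xe; apply: (@root_lt _ _ _ N) => //; rewrite -cmodX rN cmod_toC.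
(* If [Psi] vanished near [0], the branch would stay at [1] on the circle, contradicting the lower
   contact bound at [x > 0]. *)
case: (power_series_order Psi_cvg) => [/near0P[e e_gt0 Psi0]|].
  pose x := Num.min (e0 / 2) (e ^+ N / 2).
  have x0 : 0 < x by rewrite lt_min !divr_gt0 ?exprn_gt0.
  have ax : `|x| = x by rewrite gtr0_norm.
  have : x <= x by []; rewrite {2}/x le_min => /andP[xe0 xeN].
  have eN : 0 < e ^+ N by rewrite exprn_gt0.
  have [|_] := Hc x; first by rewrite ax; lra.
  rewrite Psi0 ?cayley0 ?cmod1 ?subrr ?mulr0; last first.
    by apply: rsmall; rewrite ?ltW // ax; lra.
  by rewrite leNgt exprn_gt0 // ax.
move=> [M [H [rho [L [rho0 L0 H00 [PsiE PsiL HL]]]]]].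
have M0 : (0 < M)%N.
  rewrite lt0n; apply/eqP => M0; have := PsiE 0; rewrite cmod0 => /(_ (ltW rho0)).
  by rewrite Psi00 M0 expr0 mul1r => /esym/eqP; rewrite (negbTE H00).
have small (d : R) : 0 < d -> exists2 e : R, 0 < e & forall s, cmod s < e ->
    cmod (Psi s) < d /\ cmod (s ^+ N) < d.
  move=> d0; have L1 : 0 < L + 1 by lra.
  exists (Num.min (Num.min rho 1) (Num.min d (d / (L + 1)))).
    by rewrite !lt_min rho0 ltr01 d0 divr_gt0.
  move=> s; rewrite !lt_min ltr_pdivlMr // -andbA => /and4P[sr s1 sd sL].
  split; last exact: le_lt_trans (cmodX_le N0 (ltW s1)) sd.
  have := PsiL s 0 (ltW sr); rewrite cmod0 Psi00 !subr0 => /(_ (ltW rho0)).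
  by have := cmod_ge0 s; lra.
have Im_gtN1 (w : C) : cmod w < 1 -> -1 < Im w.
  by move=> w1; have := Im_le_cmod w; rewrite ler_norml => /andP[]; lra.
have [e2 e20 He2] : exists2 e2 : R, 0 < e2 & forall s, cmod s < e2 ->
    Im (s ^+ N) < 0 -> Im (Psi s) < 0 -> False.
  have [|e e_gt0 He] := small (Num.min e1 1); first by rewrite lt_min e10 ltr01.
  exists e => // s /He[]; rewrite !lt_min => /andP[p1 p2] /andP[s1 s2] l1 l2.
  have /eqP := Psi_zero s p1 s1; apply/negP.
  by apply: cayley_pullback_lower => //=; rewrite ?l1 ?l2 Im_gtN1.
have [MN H0] := leading_term_sign N0 M0 rho0 L0 e20 H00 PsiE HL He2.
rewrite {}MN {M M0} in PsiE.
have [D [mu [delta [D0 mu0 delta0 Hreal]]]] :=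
  real_value_near K N0 rho0 L0 c0 PsiE PsiL HL H0.
(* With [|y| >= mu x], this constant turns [D x^(K+2)] into a bound by [|y|^(K+2)]. *)
have [|e3 e30 He3] := Hgt (D / mu ^+ K.+2); first by rewrite divr_gt0 ?exprn_gt0.
have [|e4 e40 He4] := small (Num.min (Num.min e1 e3) (1 / 4)).
  by rewrite !lt_min e10 e30 divr_gt0.
have e4N : 0 < (e4 / 2) ^+ N by rewrite exprn_gt0 // divr_gt0.
(* The last term gives [|s0| < e4 / 2], so that the point [s], with [|s| <= 2 |s0|], stays within
   [e4]. *)
pose x := Num.min (Num.min (e0 / 2) (delta / 2)) ((e4 / 2) ^+ N / 2).
have x0 : 0 < x by rewrite !lt_min !divr_gt0.
have ax : `|x| = x by rewrite gtr0_norm.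
have : x <= x by []; rewrite {2}/x !le_min -andbA => /and3P[xe0 xdelta xe4].
set s0 := r (toC x).
have s0e : cmod s0 < e4 / 2 by apply: rsmall; rewrite ?ax ?divr_ge0 ?ltW //; lra.
have [|Psi0 _] := He4 s0; first by lra.
rewrite !lt_min -!andbA in Psi0; case/and3P: Psi0 => _ _ Psi04.
have [|up lo] := Hc x; first by rewrite ax; lra.
rewrite ax -/s0 in up lo.
(* A negative height would put the branch outside the closed disk, whereas the lower contact bound
   makes [1 - |psi|] positive. *)
have Im0 : 0 <= Im (Psi s0).
  rewrite leNgt; apply/negP => Ineg.
  have := cmod_cayley_gt1 (Im_gtN1 _ _) Ineg => /(_ ltac:(lra)) gt1.
  have : 0 < x ^+ K.+2 by rewrite exprn_gt0.
  by move: lo gt1 c0; move: (cmod _) (x ^+ _) => a b; nra.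
have ImB : Im (Psi s0) <= c * x ^+ K.+2.
  by apply: Im_le_cayley up => //; rewrite mulr_ge0 ?exprn_ge0 ?ltW.
have [|||s [s2 Ims sN sP]] := Hreal s0 x.
- by rewrite x0 /=; lra.
- exact: rN.
- by rewrite Im0.
have [|] := He4 s; first by lra.
rewrite !lt_min -!andbA => /and3P[p1 p3 p4] /and3P[q1 q3 q4].
have PsiR : Psi s = toC (Re (Psi s)) by rewrite {1}[Psi s]complexE Ims /toC mulr0 addr0.
have yP : `|Re (Psi s)| = cmod (Psi s) by rewrite PsiR cmod_toC.
have y0 : 0 < cmod (Psi s) by apply: lt_le_trans sP; rewrite mulr_gt0.
have := He3 (s ^+ N) (Re (Psi s)); rewrite -normr_gt0 yP -PsiR => /(_ y0 q3 p3).
rewrite (cayley_pullback_swap m n f (Psi s, s ^+ N)) Psi_zero // => /(_ erefl).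
rewrite ltNge => /negP; apply.
have -> : Im (s ^+ N) = Im (s ^+ N - toC x) by rewrite cImD cImN /= oppr0 addr0.
apply: le_trans (ler_norm _) _; apply: le_trans (Im_le_cmod _) _.
apply: le_trans sN _; rewrite mulrAC ler_pdivlMr ?exprn_gt0 // -mulrA ler_pM2l //.
by rewrite -exprMn mulrC lerXn2r ?nnegrE ?cmod_ge0 // mulr_ge0 // ltW.
Qed.
End ContactOrder.

Theorem theorem4p1 (R : realType) (m n : nat) (p : {poly {poly (Cplx R)}})
    (phi : Cplx R * Cplx R -> Cplx R) (K1 K2 : nat) :
  A1 m n p phi ->
  z1_contact_order m n p K1 ->
  z2_contact_order m n p K2 ->
  K1 = K2.
Proof.
move=> [bd _ _ pD _ _ _] h1 h2; apply/eqP; rewrite eqn_leq; apply/andP; split.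
  by apply: contact_order_le h1 h2 => z; exact: reflection_exterior.
(* Exchanging the variables twice restores the reflection, so the same comparison applies in the
   other direction. *)
apply: contact_order_le h2 _ => [z z1 z2|]; first exact: reflection_exterior.
by rewrite (_ : (fun z => _) = ev (reflection m n p)) //; apply/funext => -[].
Qed.
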